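(* Let $g:\mathbb{R}^n\to\mathbb{R}^m$, $h:\mathbb{R}^n\to\mathbb{R}^p$ be continuously differentiable, let $\kappa<n$ be an integer, and let $x^*$ be feasible for CCOP, i.e. $g(x^* )\le 0$, $h(x^* )=0$, $\|x^*\|_0\le\kappa$. If the CC-AM-regularity condition holds at $x^*$, then the CC-PAM-regularity condition holds at $x^*$.
   Context: $\|x\|_0$ is the number of nonzero components of $x$. $\nabla g(x)$, $\nabla h(x)$ have columns $\nabla g_i(x)$, $\nabla h_j(x)$. $I_g(x)=\{i: g_i(x)=0\}$, $I_\pm(x)=\{\imath: x_\imath\ne 0\}$. The point $x^*$ is fixed in the following definitions. $\hat\Theta(x)$ is the set of all vectors $\nabla g(x)\lambda+\nabla h(x)\mu+\gamma$ with $(\lambda,\mu,\gamma)\in\mathbb{R}^m_+\times\mathbb{R}^p\times\mathbb{R}^n$, $\lambda_i=0$ for all $i\notin I_g(x^* )$, and $\gamma_\imath=0$ for all $\imath\in I_\pm(x^* )$. CC-AM-regularity at $x^*$ means $\limsup_{x\to x^*}\hat\Theta(x)\subseteq\hat\Theta(x^* )$, where $\limsup_{x\to x^*}\hat\Theta(x)=\{z:\exists x^k\to x^*,\ \exists z^k\to z,\ z^k\in\hat\Theta(x^k)\}$. For $\alpha,\beta\ge0$, $\Theta(x,\alpha,\beta)$ is the set of all $\nabla g(x)\lambda+\nabla h(x)\mu+\gamma$ with $(\lambda,\mu,\gamma)$ as in the definition of $\hat\Theta(x)$ and additionally, with $\pi=\|(1,\lambda,\mu,\gamma)\|_\infty$: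 $\lambda_i g_i(x)\ge\alpha$ whenever $\lambda_i>\beta\pi$; $\mu_j h_j(x)\ge\alpha$ whenever $|\mu_j|>\beta\pi$; $\gamma_\imath x_\imath\ge\alpha$ whenever $|\gamma_\imath|>\beta\pi$. CC-PAM-regularity at $x^*$ means $\limsup_{x\to x^*,\,\alpha\downarrow0,\,\beta\downarrow0}\Theta(x,\alpha,\beta)\subseteq\Theta(x^*,0,0)$, where this limsup is the set of all $z$ for which there exist $x^k\to x^*$, $\alpha_k\downarrow0$, $\beta_k\downarrow 0$ (with $\alpha_k,\beta_k>0$) and $z^k\in\Theta(x^k,\alpha_k,\beta_k)$ with $z^k\to z$. *)

(* Defs.v *)
From HB Require Import structures.
From mathcomp Require Import all_boot all_order all_algebra.
From mathcomp Require Import all_classical all_reals all_analysis.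
Set Implicit Arguments.
Unset Strict Implicit.
Unset Printing Implicit Defensive.
Import Order.TTheory GRing.Theory Num.Theory.
Import numFieldNormedType.Exports.
Local Open Scope classical_set_scope.
Local Open Scope ring_scope.

(* Points of R^n are row vectors, the convention under which the library
   defines the Jacobian. *)

Definition C1 (R : realType) (n q : nat) (f : 'rV[R]_n -> 'rV[R]_q) : Prop :=
  (forall x, differentiable f x) /\ continuous (fun x => 'J f x).

Definition l0norm (R : realType) (n : nat) (x : 'rV[R]_n) : nat :=
  #|[set i : 'I_n | x 0 i != 0]|%SET.

Definition CCOP_feasible (R : realType) (n m p : nat)
    (g : 'rV[R]_n -> 'rV[R]_m) (h : 'rV[R]_n -> 'rV[R]_p) (kappa : int)
    (x : 'rV[R]_n) : Prop :=
  [/\ forall i, g x 0 i <= 0, h x = 0 & ((l0norm x)%:Z <= kappa)%R].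

Definition active_g (R : realType) (n m : nat)
    (g : 'rV[R]_n -> 'rV[R]_m) (x : 'rV[R]_n) : set 'I_m :=
  [set i | g x 0 i = 0].

Definition I_pm (R : realType) (n : nat) (x : 'rV[R]_n) : set 'I_n :=
  [set i | x 0 i != 0].

(* Since 'J acts on row vectors from the right, 'J f x is the n x q matrix whose
   columns are the gradients of the components of f; hence l *m ('J f x)^T is
   the transpose of the product of that matrix with the column vector l^T. *)
Definition mult_comb (R : realType) (n m p : nat)
    (g : 'rV[R]_n -> 'rV[R]_m) (h : 'rV[R]_n -> 'rV[R]_p) (x : 'rV[R]_n)
    (lam : 'rV[R]_m) (mu : 'rV[R]_p) (gam : 'rV[R]_n) : 'rV[R]_n :=
  lam *m ('J g x)^T + mu *m ('J h x)^T + gam.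

Definition admissible_mult (R : realType) (n m : nat)
    (g : 'rV[R]_n -> 'rV[R]_m) (xs : 'rV[R]_n)
    (lam : 'rV[R]_m) (gam : 'rV[R]_n) : Prop :=
  [/\ forall i, 0 <= lam 0 i,
      forall i, ~ active_g g xs i -> lam 0 i = 0
    & forall i, I_pm xs i -> gam 0 i = 0].

Definition Theta_hat (R : realType) (n m p : nat)
    (g : 'rV[R]_n -> 'rV[R]_m) (h : 'rV[R]_n -> 'rV[R]_p)
    (xs x : 'rV[R]_n) : set 'rV[R]_n :=
  [set z | exists lam mu gam,
     admissible_mult g xs lam gam /\ z = mult_comb g h x lam mu gam].

(* The norm on matrices is the maximum of the absolute values of the entries. *)
Definition mult_size (R : realType) (n m p : nat)
    (lam : 'rV[R]_m) (mu : 'rV[R]_p) (gam : 'rV[R]_n) : R :=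
  `| row_mx (const_mx 1 : 'rV[R]_1) (row_mx lam (row_mx mu gam)) |.

Definition Theta (R : realType) (n m p : nat)
    (g : 'rV[R]_n -> 'rV[R]_m) (h : 'rV[R]_n -> 'rV[R]_p)
    (xs x : 'rV[R]_n) (alpha beta : R) : set 'rV[R]_n :=
  [set z | exists lam mu gam,
     let pi := mult_size lam mu gam in
     [/\ admissible_mult g xs lam gam,
         forall i, beta * pi < lam 0 i -> alpha <= lam 0 i * g x 0 i,
         forall j, beta * pi < `|mu 0 j| -> alpha <= mu 0 j * h x 0 j,
         forall i, beta * pi < `|gam 0 i| -> alpha <= gam 0 i * x 0 i
       & z = mult_comb g h x lam mu gam]].

Definition limsup_Theta_hat (R : realType) (n m p : nat)
    (g : 'rV[R]_n -> 'rV[R]_m) (h : 'rV[R]_n -> 'rV[R]_p)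
    (xs : 'rV[R]_n) : set 'rV[R]_n :=
  [set z | exists x_ z_ : nat -> 'rV[R]_n,
     [/\ x_ @ \oo --> xs, z_ @ \oo --> z
       & forall k, Theta_hat g h xs (x_ k) (z_ k)]].

Definition limsup_Theta (R : realType) (n m p : nat)
    (g : 'rV[R]_n -> 'rV[R]_m) (h : 'rV[R]_n -> 'rV[R]_p)
    (xs : 'rV[R]_n) : set 'rV[R]_n :=
  [set z | exists (x_ z_ : nat -> 'rV[R]_n) (a_ b_ : nat -> R),
     [/\ x_ @ \oo --> xs, z_ @ \oo --> z,
         (forall k, 0 < a_ k) /\ a_ @ \oo --> 0,
         (forall k, 0 < b_ k) /\ b_ @ \oo --> 0
       & forall k, Theta g h xs (x_ k) (a_ k) (b_ k) (z_ k)]].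

Definition CC_AM_regular (R : realType) (n m p : nat)
    (g : 'rV[R]_n -> 'rV[R]_m) (h : 'rV[R]_n -> 'rV[R]_p)
    (xs : 'rV[R]_n) : Prop :=
  limsup_Theta_hat g h xs `<=` Theta_hat g h xs xs.

Definition CC_PAM_regular (R : realType) (n m p : nat)
    (g : 'rV[R]_n -> 'rV[R]_m) (h : 'rV[R]_n -> 'rV[R]_p)
    (xs : 'rV[R]_n) : Prop :=
  limsup_Theta g h xs `<=` Theta g h xs xs 0 0.

(* Main.v *)
Require Import Defs.
From mathcomp Require Import all_boot all_order all_algebra.
From mathcomp Require Import all_classical all_reals all_analysis.
Set Implicit Arguments.
Unset Strict Implicit.
Unset Printing Implicit Defensive.
Import Order.TTheory GRing.Theory Num.Theory.
Import numFieldNormedType.Exports.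
Local Open Scope classical_set_scope.
Local Open Scope ring_scope.

(** The proof is a chain of inclusions: limsup Theta ⊆ limsup Theta_hat ⊆ Theta_hat(xs) ⊆
    Theta(xs,0,0). The first holds because Theta(x,alpha,beta) is Theta_hat(x) cut down by sign
    conditions, so the same sequences serve; the second is CC-AM-regularity. The last,
    [Theta_hat_sub_Theta0], is where feasibility enters: at xs itself complementarity and h(xs) = 0
    turn every sign condition into 0 <= 0. *)

Lemma Theta_sub_Theta_hat (R : realType) (n m p : nat)
    (g : 'rV[R]_n -> 'rV[R]_m) (h : 'rV[R]_n -> 'rV[R]_p)
    (xs x : 'rV[R]_n) (alpha beta : R) :
  Theta g h xs x alpha beta `<=` Theta_hat g h xs x.
Proof. by move=> z [lam [mu [gam [adm _ _ _ ->]]]]; exists lam, mu, gam. Qed.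

Lemma limsup_Theta_sub_limsup_Theta_hat (R : realType) (n m p : nat)
    (g : 'rV[R]_n -> 'rV[R]_m) (h : 'rV[R]_n -> 'rV[R]_p) (xs : 'rV[R]_n) :
  limsup_Theta g h xs `<=` limsup_Theta_hat g h xs.
Proof.
move=> z [x_ [z_ [a_ [b_ [cvx cvz _ _ zT]]]]]; exists x_, z_; split=> // k.
exact: Theta_sub_Theta_hat (zT k).
Qed.

(* At xs itself all the products lam_i g_i, mu_j h_j and gam_i xs_i vanish. *)
Lemma Theta_hat_sub_Theta0 (R : realType) (n m p : nat)
    (g : 'rV[R]_n -> 'rV[R]_m) (h : 'rV[R]_n -> 'rV[R]_p) (xs : 'rV[R]_n)
    (beta : R) :
  h xs = 0 -> Theta_hat g h xs xs `<=` Theta g h xs xs 0 beta.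
Proof.
move=> hxs z [lam [mu [gam [adm ->]]]]; have [_ lam0 gam0] := adm.
(* The multipliers are kept. With alpha = 0 each remaining goal asks for a nonnegative product, and
   in each product one factor is zero, by activity, by h(xs) = 0 or by admissibility. *)
exists lam, mu, gam; split=> // i _.
- have [gi|gi] := pselect (active_g g xs i); first by rewrite gi mulr0.
  by rewrite lam0 // mul0r.
- by rewrite hxs mxE mulr0.
- have [->|xi] := eqVneq (xs 0 i) 0; first by rewrite mulr0.
  by rewrite gam0 // mul0r.
Qed.

Theorem mainTheorem6 (R : realType) (n m p : nat)
    (g : 'rV[R]_n -> 'rV[R]_m) (h : 'rV[R]_n -> 'rV[R]_p)
    (kappa : int) (xs : 'rV[R]_n) :
  C1 g -> C1 h ->
  (kappa < n%:Z)%R ->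
  CCOP_feasible g h kappa xs ->
  CC_AM_regular g h xs ->
  CC_PAM_regular g h xs.
Proof.
move=> _ _ _ [_ hxs _] AM z /limsup_Theta_sub_limsup_Theta_hat /AM.
exact: Theta_hat_sub_Theta0.
Qed.
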